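(* Let ${\sf SimpNormal}$ be the following formula about an infinite binary sequence $x\in 2^\omega$, expressing that $x$ is simply normal in base $2$: $$\forall k\ \exists s\ \forall t\ge s.\ \left|{\sf Freq}_1(x\upharpoonright t)-\tfrac12\right|\le\tfrac1{k+1}.$$ Then ${\sf SimpNormal}$ is $\forall^{\downarrow}\forall^\infty$-dicomplete.
   Context: For a binary string $\sigma$ of length $n\geq 1$, ${\sf Freq}_1(\sigma)=\#\{k<n:\sigma(k)=1\}/n$ (the value for the empty string is immaterial), and $x\upharpoonright t$ is the initial segment of $x$ of length $t$. Quantifiers range over $\omega$. $\exists^\infty n\,\varphi(n)$ means $\forall m\exists n\ge m\,\varphi(n)$ and $\forall^\infty n\,\varphi(n)$ means $\exists m\forall n\ge m\,\varphi(n)$. A quantifier-pattern is a finite string $\bar{\mathsf Q}=\mathsf Q_0\dots\mathsf Q_\ell$ over $\{\exists,\forall,\exists^\infty,\forall^\infty\}$. A $\bar{\mathsf Q}$-formula is $\varphi(\bar x)\equiv\mathsf Q_0n_0\dots\mathsf Q_\ell n_\ell\,\theta(n_0,\dots,n_\ell,\bar x)$ with $\theta$ a bounded formula. The instance $\bar x$ is a tuple of natural numbers and/or total computable functions (computable elements of $\omega^\omega$; for ${\sf SimpNormal}$, computable elements of $2^\omega$). Spaces such as $\omega\times\omega^\omega$, $(\omega^\omega)^\omega$, $\omega^{\omega\times\omega}$ are identified with $\omega^\omega$ by computable pairing. Witnesses: for $\alpha\in\omega^\omega$, $\alpha\Vdash\varphi(\bar x)$ (''$\alpha$ is a witness for $\varphi(\bar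 x)$'') is defined by: $\alpha\Vdash\theta(\bar x)$ iff $\alpha=\bar x$ and $\theta(\bar x)$, for bounded $\theta$; $\langle t,\alpha\rangle\Vdash\exists n\varphi(n,\bar x)$ iff $\alpha\Vdash\varphi(t,\bar x)$; $\alpha\Vdash\forall n\varphi(n,\bar x)$ iff $\alpha(n)\Vdash\varphi(n,\bar x)$ for all $n$; $\langle t,\alpha\rangle\Vdash\forall^\infty n\varphi(n,\bar x)$ iff $\alpha(n)\Vdash\varphi(n,\bar x)$ for all $n\ge t$; $\alpha\Vdash\exists^\infty n\varphi(n,\bar x)$ iff for all $n$, writing $\alpha(n)=\langle k,\beta\rangle$, $k\ge n$ and $\beta\Vdash\varphi(k,\bar x)$. Reducibility: $\varphi\le_{\sf m}\psi$ if there are computable functions $\eta,r_-,r_+$ (type-two computable functionals, possibly partial but defined wherever required) such that for every instance $\bar x$: $\varphi(\bar x)$ is true iff $\psi(\eta(\bar x))$ is true; $\alpha\Vdash\varphi(\bar x)$ implies $r_-(\alpha,\bar x)\Vdash\psi(\eta(\bar x))$; $\alpha\Vdash\psi(\eta(\bar x))$ implies $r_+(\alpha,\bar x)\Vdash\varphi(\bar x)$ ($\alpha\in\omega^\omega$ arbitrary). The dual $\varphi^{\sf d}$ of $\mathsf Q_0n_0\dots\mathsf Q_\ell n_\ell\,\theta$ is $\mathsf Q_0^{\sf d}n_0\dots\mathsf Q_\ell^{\sf d}n_\ell\,\neg\theta$, where $\exists^{\sf d}=\forall$, $\forall^{\sf d}=\exists$, $(\exists^\infty)^{\sf d}=\forall^\infty$,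 $(\forall^\infty)^{\sf d}=\exists^\infty$. $\varphi\le_{\sf dm}\psi$ if $\varphi\le_{\sf m}\psi$ and $\varphi^{\sf d}\le_{\sf m}\psi^{\sf d}$ via a common $\eta$ (the $r_\pm$ may differ). A formula $\psi(a,x)$ is descending if $a'\le a$ and $\psi(a,x)$ imply $\psi(a',x)$. A $\forall^{\downarrow}\forall^\infty$-formula is a formula $\forall a\,\psi(a,x)$ where $\psi(a,x)$ is a descending $\forall^\infty$-formula; its dual is the dual as a $\forall\forall^\infty$-formula. A formula is strictly $\forall^{\downarrow}\forall^\infty$-dicomplete if it is a $\forall^{\downarrow}\forall^\infty$-formula and every $\forall^{\downarrow}\forall^\infty$-formula is $\le_{\sf dm}$-reducible to it; it is $\forall^{\downarrow}\forall^\infty$-dicomplete if it is $\equiv_{\sf dm}$-equivalent to a strictly $\forall^{\downarrow}\forall^\infty$-dicomplete formula. *)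

(* Defs.v *)
From mathcomp Require Import all_boot all_order all_algebra.
From Stdlib Require Cantor.

Set Implicit Arguments.
Unset Strict Implicit.
Unset Printing Implicit Defensive.

Import Order.TTheory GRing.Theory Num.Theory.

(** * Pairings *)

Definition npair (a b : nat) : nat := Cantor.to_nat (a, b).
Definition nfst (n : nat) : nat := (Cantor.of_nat n).1.
Definition nsnd (n : nat) : nat := (Cantor.of_nat n).2.

(** The identifications of [omega * omega^omega], [omega^omega * omega^omega]
    and [(omega^omega)^omega] with [omega^omega].  The first one, [<n, alpha>],
    is given with its two projections: [alpha] represents
    [<alpha 0, ftail alpha>].  An [alpha] seen in [(omega^omega)^omega] has
    [section alpha n] as its [n]-th component. *)
Definition fcons (n : nat) (alpha : nat -> nat) : nat -> nat :=
  fun i => if i is j.+1 then alpha j else n.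
Definition ftail (alpha : nat -> nat) : nat -> nat := fun i => alpha i.+1.
Definition fjoin (alpha beta : nat -> nat) : nat -> nat :=
  fun i => if odd i then beta i./2 else alpha i./2.
Definition section (alpha : nat -> nat) (n : nat) : nat -> nat :=
  fun i => alpha (npair n i).

(** Finite strings of natural numbers as natural numbers (a bijection). *)
Definition strcode (s : seq nat) : nat :=
  foldl (fun c a => (npair c a).+1) 0 s.

(** * Computability *)

(** Programs for partial functions [nat -> nat] relative to an oracle in
    [omega^omega]; several arguments are passed through [npair]. *)
Inductive code : Type :=
| Zero | Succ | Fst | Snd | Oracle
| Pair of code & code
| Comp of code & code
| Prec of code & code
| Rfind of code.

(** [eval o c n m]: with oracle [o], program [c] halts on [n] with output [m]. *)
Inductive eval (o : nat -> nat) : code -> nat -> nat -> Prop :=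
| eval_zero n : eval o Zero n 0
| eval_succ n : eval o Succ n n.+1
| eval_fst n : eval o Fst n (nfst n)
| eval_snd n : eval o Snd n (nsnd n)
| eval_oracle n : eval o Oracle n (o n)
| eval_pair c d n a b :
    eval o c n a -> eval o d n b -> eval o (Pair c d) n (npair a b)
| eval_comp c d n a b :
    eval o d n a -> eval o c a b -> eval o (Comp c d) n b
| eval_prec0 c d n a :
    eval o c n a -> eval o (Prec c d) (npair n 0) a
| eval_precS c d n i a b :
    eval o (Prec c d) (npair n i) a ->
    eval o d (npair n (npair i a)) b ->
    eval o (Prec c d) (npair n i.+1) b
| eval_rfind c n k (val : nat -> nat) :
    (forall i, i < k -> eval o c (npair n i) (val i).+1) ->
    eval o c (npair n k) 0 -> eval o (Rfind c) n k.

(** The partial computable functional on [omega^omega] given by [c] is defined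
    at [alpha], with value [beta]. *)
Definition computes (c : code) (alpha beta : nat -> nat) : Prop :=
  forall n, eval alpha c n (beta n).

Definition computable (f : nat -> nat) : Prop :=
  exists c, computes c (fun=> 0) f.

Fixpoint primitive (c : code) : bool :=
  match c with
  | Oracle | Rfind _ => false
  | Pair c d | Comp c d | Prec c d => primitive c && primitive d
  | _ => true
  end.

Definition primrec (f : nat -> nat) : Prop :=
  exists2 c, primitive c & computes c (fun=> 0) f.

(** * Tuples of numbers and functions *)

Inductive value : Type :=
| VNat of nat
| VFun of (nat -> nat).

Inductive sort : Type := SNat | SBaire | SCantor.

(** [num v i] and [fn v i] read the [i]-th entry of a tuple; the default
    values are only met on tuples of the wrong shape. *)
Definition num (v : seq value) (i : nat) : nat :=
  if nth (VNat 0) v i is VNat n then n else 0.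
Definition fn (v : seq value) (i : nat) : nat -> nat :=
  if nth (VNat 0) v i is VFun f then f else fun=> 0.

Fixpoint enc (v : seq value) : nat -> nat :=
  match v with
  | [::] => fun=> 0
  | [:: VFun f] => f
  | VFun f :: v' => fjoin f (enc v')
  | VNat n :: v' => fcons n (enc v')
  end.

Fixpoint instance (ss : seq sort) (v : seq value) : Prop :=
  match ss, v with
  | [::], [::] => True
  | SNat :: ss', VNat _ :: v' => instance ss' v'
  | SBaire :: ss', VFun f :: v' => computable f /\ instance ss' v'
  | SCantor :: ss', VFun f :: v' =>
      [/\ computable f, forall i, f i < 2 & instance ss' v']
  | _, _ => False
  end.

(** * Bounded formulas *)

(** The predicates definable by a bounded formula in the language with
    variables [x_i] for numbers and functions, application [x_i(t)], the
    (code of the) initial segment of [x_i] of length [t], pairing, and a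
    symbol for every primitive recursive function.  A bound number variable
    is added at the head of the tuple. *)
Inductive is_term : (seq value -> nat) -> Prop :=
| term_var i : is_term (fun v => num v i)
| term_app i t : is_term t -> is_term (fun v => fn v i (t v))
| term_seg i t : is_term t -> is_term (fun v => strcode (mkseq (fn v i) (t v)))
| term_pair t u : is_term t -> is_term u -> is_term (fun v => npair (t v) (u v))
| term_prim f t : primrec f -> is_term t -> is_term (fun v => f (t v)).

Inductive bounded : (seq value -> Prop) -> Prop :=
| bounded_eq t u : is_term t -> is_term u -> bounded (fun v => t v = u v)
| bounded_lt t u : is_term t -> is_term u -> bounded (fun v => t v < u v)
| bounded_not A : bounded A -> bounded (fun v => ~ A v)
| bounded_and A B : bounded A -> bounded B -> bounded (fun v => A v /\ B v)
| bounded_or A B : bounded A -> bounded B -> bounded (fun v => A v \/ B v)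
| bounded_all t A : is_term t -> bounded A ->
    bounded (fun v => forall n, n < t v -> A (VNat n :: v))
| bounded_ex t A : is_term t -> bounded A ->
    bounded (fun v => exists2 n, n < t v & A (VNat n :: v))
| bounded_equiv A B : bounded A -> (forall v, A v <-> B v) -> bounded B.

(** * Formulas, truth and witnesses *)

Inductive quant : Type := QEx | QAll | QExInf | QAllInf.

Definition dualq (q : quant) : quant :=
  match q with
  | QEx => QAll | QAll => QEx | QExInf => QAllInf | QAllInf => QExInf
  end.

(** [Formula [:: Q_0; ..; Q_l] ss theta] is
    [Q_0 n_0 .. Q_l n_l. theta (n_l, .., n_0, x)] with parameters [x] of sorts
    [ss].  Thus if [Formula qs (SNat :: ss) theta] is [psi (a, x)], then
    [Formula (Q :: qs) ss theta] is [Q a. psi (a, x)].  That [theta] is bounded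
    is required separately. *)
Record formula : Type := Formula {
  prefix : seq quant;
  params : seq sort;
  matrix : seq value -> Prop
}.

Fixpoint truth (qs : seq quant) (theta : seq value -> Prop) (v : seq value) :
    Prop :=
  match qs with
  | [::] => theta v
  | QEx :: qs' => exists n, truth qs' theta (VNat n :: v)
  | QAll :: qs' => forall n, truth qs' theta (VNat n :: v)
  | QExInf :: qs' =>
      forall m, exists n, m <= n /\ truth qs' theta (VNat n :: v)
  | QAllInf :: qs' =>
      exists m, forall n, m <= n -> truth qs' theta (VNat n :: v)
  end.

Fixpoint wit (qs : seq quant) (theta : seq value -> Prop) (v : seq value)
    (alpha : nat -> nat) : Prop :=
  match qs with
  | [::] => alpha =1 enc v /\ theta v
  | QEx :: qs' => wit qs' theta (VNat (alpha 0) :: v) (ftail alpha)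
  | QAll :: qs' => forall n, wit qs' theta (VNat n :: v) (section alpha n)
  | QExInf :: qs' => forall n,
      let beta := section alpha n in
      n <= beta 0 /\ wit qs' theta (VNat (beta 0) :: v) (ftail beta)
  | QAllInf :: qs' => forall n, alpha 0 <= n ->
      wit qs' theta (VNat n :: v) (section (ftail alpha) n)
  end.

Definition holds (phi : formula) (x : seq value) : Prop :=
  truth (prefix phi) (matrix phi) x.

Definition witness (phi : formula) (x : seq value) (alpha : nat -> nat) : Prop :=
  wit (prefix phi) (matrix phi) x alpha.

Definition dual (phi : formula) : formula :=
  Formula (map dualq (prefix phi)) (params phi) (fun v => ~ matrix phi v).

(** * Reducibility *)

(** [phi] is many-one reducible to [psi] with [eta] the functional given by
    [e]; here [y] is [eta x], which is determined by its code [enc y]. *)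
Definition reduces_via (e : code) (phi psi : formula) : Prop :=
  exists rminus rplus : code, forall x, instance (params phi) x ->
  exists y, [/\ instance (params psi) y,
    computes e (enc x) (enc y),
    holds phi x <-> holds psi y,
    forall alpha, witness phi x alpha ->
      exists2 beta, computes rminus (fjoin alpha (enc x)) beta
                  & witness psi y beta
  & forall alpha, witness psi y alpha ->
      exists2 beta, computes rplus (fjoin alpha (enc x)) beta
                  & witness phi x beta].

Definition le_dm (phi psi : formula) : Prop :=
  exists e, reduces_via e phi psi /\ reduces_via e (dual phi) (dual psi).

Definition equiv_dm (phi psi : formula) : Prop :=
  le_dm phi psi /\ le_dm psi phi.

Definition strictly_dicomplete (C : formula -> Prop) (psi : formula) : Prop :=
  C psi /\ forall phi, C phi -> le_dm phi psi.

Definition dicomplete (C : formula -> Prop) (phi : formula) : Prop :=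
  bounded (matrix phi) /\
  exists2 psi, strictly_dicomplete C psi & equiv_dm phi psi.

(** * Descending formulas *)

(** [psi (a, x)], the parameter [a] being the head of the tuple. *)
Definition descending (psi : formula) : Prop :=
  forall a a' x, instance (params psi) (VNat a :: x) -> a' <= a ->
  holds psi (VNat a :: x) -> holds psi (VNat a' :: x).

Definition all_down_allinf (phi : formula) : Prop :=
  exists ss theta, [/\ bounded theta,
    descending (Formula [:: QAllInf] (SNat :: ss) theta)
  & phi = Formula [:: QAll; QAllInf] ss theta].

(** * Simple normality *)

Definition freq1 (s : seq nat) : rat :=
  ((count (pred1 1%N) s)%:R / (size s)%:R)%R.

(** The tuple seen by the matrix is [(t, k, x)]; the quantifiers
    [exists s, forall t >= s] of the definition are [QAllInf]. *)
Definition SimpNormal : formula :=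
  Formula [:: QAll; QAllInf] [:: SCantor] (fun v =>
    let t := num v 0 in let k := num v 1 in let x := fn v 2 in
    (`|freq1 (mkseq x t) - 1 / 2%:R| <= 1 / (k.+1)%:R)%R).

(* Main.v *)
From mathcomp Require Import all_boot all_order all_algebra.
From mathcomp Require Import zify ring.
From Stdlib Require Cantor Classical_Prop.
Require Import Defs.

(** [SimpNormal] is itself a descending formula, so it suffices to reduce every
    formula [forall a, forall^infty n, theta (n, a, x)] to it.  Let the label of
    [n] be the least [a < n] such that [theta (n, a, x)] fails, or [n] if there
    is none.  The sequence [wave_seq] is written in stages: in stage [n] it
    emits ones until the frequency of ones exceeds [1/2] by more than
    [1 / (2 (a + 2))], where [a] is the label of [n], and then zeros until the
    frequency is [1/2] again.  So deviations above [1 / (k + 1)] eventually come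
    only from labels below [k], and each failure of [theta (n, a, x)] with
    [a <= n] produces a deviation above [1 / (2 a + 4)] after time [n].  This
    transforms bounds for one formula into bounds for the other.  For the dual
    formulas the witness only has to supply its first component: infinitely
    many deviations above [1 / (k + 1)] yield some [a < k] with infinitely many
    failures, hence, the formula being descending, [k] itself has infinitely
    many failures, which can be found by unbounded search. *)

Set Implicit Arguments.
Unset Strict Implicit.
Unset Printing Implicit Defensive.

Import Order.TTheory GRing.Theory Num.Theory.

(** * Uniformly computable functionals *)

Lemma nfst_npair a b : nfst (npair a b) = a.
Proof. by rewrite /nfst /npair Cantor.cancel_of_to. Qed.

Lemma nsnd_npair a b : nsnd (npair a b) = b.
Proof. by rewrite /nsnd /npair Cantor.cancel_of_to. Qed.

Lemma npair_eta n : npair (nfst n) (nsnd n) = n.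
Proof. by rewrite /nfst /nsnd /npair -surjective_pairing Cantor.cancel_to_of. Qed.

Definition npairE := (nfst_npair, nsnd_npair).

(** [F i] is computable from [o i] by a program that does not depend on [i].
    A functional that is only defined on certain oracles is expressed by letting
    the indices carry a proof that their oracle is one of these.  The program
    must be primitive recursive if [b] is true. *)
Definition ucomp (b : bool) (I : Type) (o F : I -> nat -> nat) : Prop :=
  exists2 c, b ==> primitive c & forall i n, eval (o i) c n (F i n).

Section Ucomp.
Context (b : bool) (I : Type) (o : I -> nat -> nat).
Implicit Types (F G T : I -> nat -> nat) (P Q : I -> nat -> bool).
Local Notation uc := (ucomp b o).

Lemma ucomp_ext F G : uc F -> (forall i n, F i n = G i n) -> uc G.
Proof. by case=> c pc Fc FG; exists c => // i n; rewrite -FG. Qed.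

Lemma ucomp_comp F G : uc F -> uc G -> uc (fun i n => F i (G i n)).
Proof.
case=> c pc Fc [d pd Gd]; exists (Comp c d) => [|i n].
  by case: (b) pc pd => //= -> ->.
exact: eval_comp (Gd i n) (Fc i _).
Qed.

Lemma ucomp_npair F G : uc F -> uc G -> uc (fun i n => npair (F i n) (G i n)).
Proof.
case=> c pc Fc [d pd Gd]; exists (Pair c d) => [|i n].
  by case: (b) pc pd => //= -> ->.
exact: eval_pair.
Qed.

Lemma ucomp_nfst F : uc F -> uc (fun i n => nfst (F i n)).
Proof.
apply: (@ucomp_comp (fun=> nfst)); exists Fst => [|i n]; last exact: eval_fst.
exact: implybT.
Qed.

Lemma ucomp_nsnd F : uc F -> uc (fun i n => nsnd (F i n)).
Proof.
apply: (@ucomp_comp (fun=> nsnd)); exists Snd => [|i n]; last exact: eval_snd.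
exact: implybT.
Qed.

(** The programs have no identity; since every number is a pair, re-pairing its two projections
    gives it. *)
Lemma ucomp_id : uc (fun i n => n).
Proof.
exists (Pair Fst Snd) => [|i n]; first exact: implybT.
by rewrite -{2}(npair_eta n); apply: eval_pair; constructor.
Qed.

Lemma ucomp_succ F : uc F -> uc (fun i n => (F i n).+1).
Proof.
apply: (@ucomp_comp (fun=> succn)); exists Succ => [|i n]; last exact: eval_succ.
exact: implybT.
Qed.

Lemma ucomp_const k : uc (fun i n => k).
Proof.
elim: k => [|k]; last exact: ucomp_succ.
by exists Zero => [|i n]; [exact: implybT | exact: eval_zero].
Qed.

Lemma ucomp_app2 (F : I -> nat -> nat -> nat) G T :
  uc (fun i p => F i (nfst p) (nsnd p)) -> uc G -> uc T ->
  uc (fun i n => F i (G i n) (T i n)).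
Proof.
move=> ucF ucG ucT; apply: ucomp_ext (ucomp_comp ucF (ucomp_npair ucG ucT)) _.
by move=> i n; rewrite !npairE.
Qed.

(** [F] is tied to [G] and [H] by the recursion equations only, so the lemma applies directly to
    library functions that satisfy them. *)
Lemma ucomp_rec (F : I -> nat -> nat -> nat) G H T :
    uc G -> uc (fun i p => H i (nfst p) (nfst (nsnd p)) (nsnd (nsnd p))) ->
    (forall i n, F i n 0 = G i n) ->
    (forall i n k, F i n k.+1 = H i n k (F i n k)) ->
  uc T -> uc (fun i n => F i n (T i n)).
Proof.
move=> [c pc Gc] [d pd Hd] F0 FS; apply: ucomp_app2 ucomp_id.
exists (Prec c d) => [|i p]; first by case: (b) pc pd => //= -> ->.
rewrite -{1}(npair_eta p); elim: (nsnd p) => [|k IHk].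
  by rewrite F0; apply: eval_prec0.
rewrite FS; apply: eval_precS IHk _.
by move: (Hd i (npair (nfst p) (npair k (F i (nfst p) k)))); rewrite !npairE.
Qed.

End Ucomp.

Ltac ucomp_proj :=
  do ?[exact: ucomp_id | apply: ucomp_nfst | apply: ucomp_nsnd].

(** * Arithmetic, boolean tests and search *)

Section Arithmetic.
Context (b : bool) (I : Type) (o : I -> nat -> nat).
Implicit Types (F G T : I -> nat -> nat) (P Q : I -> nat -> bool).
Local Notation uc := (ucomp b o).

Lemma ucomp_add F G : uc F -> uc G -> uc (fun i n => F i n + G i n).
Proof.
move=> ucF; apply: (@ucomp_rec _ _ _ (fun i n k => F i n + k) F
  (fun _ _ _ r => r.+1)) => //= [|i n|i n k].
- by apply: ucomp_succ; ucomp_proj.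
- exact: addn0.
- exact: addnS.
Qed.

Lemma ucomp_pred F : uc F -> uc (fun i n => (F i n).-1).
Proof.
apply: (@ucomp_rec _ _ _ (fun _ _ k => k.-1) (fun _ _ => 0)
  (fun _ _ k _ => k)) => //; [exact: ucomp_const | by ucomp_proj].
Qed.

Lemma ucomp_sub F G : uc F -> uc G -> uc (fun i n => F i n - G i n).
Proof.
move=> ucF; apply: (@ucomp_rec _ _ _ (fun i n k => F i n - k) F
  (fun _ _ _ r => r.-1)) => //= [|i n|i n k].
- by apply: ucomp_pred; ucomp_proj.
- exact: subn0.
- exact: subnS.
Qed.

Lemma ucomp_mul F G : uc F -> uc G -> uc (fun i n => F i n * G i n).
Proof.
move=> ucF; apply: (@ucomp_rec _ _ _ (fun i n k => F i n * k) (fun _ _ => 0)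
  (fun i n _ r => F i n + r)) => // [||i n|i n k].
- exact: ucomp_const.
- apply: ucomp_add; last by ucomp_proj.
  by apply: ucomp_comp ucF _; ucomp_proj.
- exact: muln0.
- exact: mulnS.
Qed.

Lemma ucomp_if P F G : uc (fun i n => P i n) -> uc F -> uc G ->
  uc (fun i n => if P i n then F i n else G i n).
Proof.
(* The truth value, read as 0 or 1, is the recursion argument: 0 selects [G] and 1 selects [F]. *)
move=> ucP ucF ucG; pose H i n k := if k is _.+1 then F i n else G i n.
apply: (@ucomp_ext _ _ _ (fun i n => H i n (P i n))) => [|i n]; last by case: (P i n).
apply: (@ucomp_rec _ _ _ H G (fun i n _ _ => F i n)) => //.
by apply: ucomp_comp ucF _; ucomp_proj.
Qed.

Lemma ucomp_neg P : uc (fun i n => P i n) -> uc (fun i n => ~~ P i n).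
Proof.
move=> ucP; apply: ucomp_ext (ucomp_sub (ucomp_const _ _ 1) ucP) _ => i n.
by case: (P i n).
Qed.

Lemma ucomp_and P Q : uc (fun i n => P i n) -> uc (fun i n => Q i n) ->
  uc (fun i n => P i n && Q i n).
Proof.
by move=> ucP ucQ; apply: ucomp_ext (ucomp_mul ucP ucQ) _ => i n; rewrite mulnb.
Qed.

Lemma ucomp_or P Q : uc (fun i n => P i n) -> uc (fun i n => Q i n) ->
  uc (fun i n => P i n || Q i n).
Proof.
move=> ucP ucQ.
apply: ucomp_ext (ucomp_neg (ucomp_and (ucomp_neg ucP) (ucomp_neg ucQ))) _.
by move=> i n; rewrite negb_and !negbK.
Qed.

Lemma ucomp_lt F G : uc F -> uc G -> uc (fun i n => F i n < G i n).
Proof.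
move=> ucF ucG.
(* With truncated subtraction, subtracting from 1 twice gives the sign of [G - F]. *)
apply: ucomp_ext (ucomp_sub (ucomp_const _ _ 1)
  (ucomp_sub (ucomp_const _ _ 1) (ucomp_sub ucG ucF))) _ => i n; lia.
Qed.

Lemma ucomp_le F G : uc F -> uc G -> uc (fun i n => F i n <= G i n).
Proof. by move=> ucF ucG; apply: ucomp_lt ucF (ucomp_succ ucG). Qed.

Lemma ucomp_eq F G : uc F -> uc G -> uc (fun i n => F i n == G i n).
Proof.
move=> ucF ucG; apply: ucomp_ext (ucomp_and (ucomp_le ucF ucG) (ucomp_le ucG ucF)) _.
by move=> i n; rewrite eqn_leq.
Qed.

Lemma ucomp_max F G : uc F -> uc G -> uc (fun i n => maxn (F i n) (G i n)).
Proof. by move=> ucF ucG; apply: ucomp_if => //; apply: ucomp_lt. Qed.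

Lemma ucomp_all (P : I -> nat -> nat -> bool) T :
    uc (fun i p => P i (nfst p) (nsnd p)) -> uc T ->
  uc (fun i n => all (P i n) (iota 0 (T i n))).
Proof.
move=> ucP; pose H i n k := nat_of_bool (all (P i n) (iota 0 k)).
apply: (@ucomp_rec _ _ _ H (fun _ _ => 1) (fun i n k r => r * P i n k)) => //.
- exact: ucomp_const.
- apply: ucomp_mul; first by ucomp_proj.
  apply: (@ucomp_app2 _ _ _ (fun i n k => nat_of_bool (P i n k))) => //;
  by ucomp_proj.
- by move=> i n k; rewrite /H -addn1 iotaD all_cat /= andbT mulnb.
Qed.

Lemma ucomp_find (P : I -> nat -> nat -> bool) T :
    uc (fun i p => P i (nfst p) (nsnd p)) -> uc T ->
  uc (fun i n => find (P i n) (iota 0 (T i n))).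
Proof.
move=> ucP; pose H i n k := find (P i n) (iota 0 k).
(* A value [r < k] is an earlier hit and is kept; otherwise [r = k], which stays if [P] holds at [k]
   and grows by one if not. *)
apply: (@ucomp_rec _ _ _ H (fun _ _ => 0)
  (fun i n k r => if r < k then r else k + ~~ P i n k)) => //.
- exact: ucomp_const.
- apply: ucomp_if; [by apply: ucomp_lt; ucomp_proj | by ucomp_proj |].
  apply: ucomp_add; first by ucomp_proj.
  apply: ucomp_neg.
  apply: (@ucomp_app2 _ _ _ (fun i n k => nat_of_bool (P i n k))) => //;
  by ucomp_proj.
- move=> i n k; rewrite /H -addn1 iotaD find_cat has_find size_iota /=.
  by case: ifP => // _; case: (P i n k).
Qed.

Lemma ucomp_fcons F (E : I -> nat -> nat -> nat) T :
    uc F -> uc (fun i p => E i (nfst p) (nsnd p)) -> uc T ->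
  uc (fun i n => fcons (F i n) (E i n) (T i n)).
Proof.
move=> ucF ucE ucT.
apply: (@ucomp_ext _ _ _ (fun i n => if T i n == 0 then F i n else E i n (T i n).-1)).
  apply: ucomp_if => //; first by apply: ucomp_eq ucT _; apply: ucomp_const.
  by apply: ucomp_app2 ucE _ _; [exact: ucomp_id | exact: ucomp_pred].
by move=> i n; case: (T i n).
Qed.

End Arithmetic.

Lemma ucomp_search I (o : I -> nat -> nat) (P : I -> nat -> nat -> bool)
    (exP : forall i n, exists k, P i n k) :
    ucomp false o (fun i p => P i (nfst p) (nsnd p)) ->
  ucomp false o (fun i n => ex_minn (exP i n)).
Proof.
move=> ucP.
have [c _ Pc] := ucomp_neg (b := false) (P := fun i p => P i (nfst p) (nsnd p)) ucP.
exists (Rfind c) => // i n; case: ex_minnP => k Pk kmin.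
(* [Rfind] looks for a zero, so it runs on the negated test; before the minimum this test returns 1,
   the successor of the 0 given here. *)
apply: (@eval_rfind _ _ _ _ (fun=> 0)) => [j ltjk|].
  have := Pc i (npair n j); rewrite !npairE; case: (boolP (P i n j)) => // Pj.
  by have := kmin j Pj; rewrite leqNgt ltjk.
by have := Pc i (npair n k); rewrite !npairE Pk.
Qed.

(** * Changing the oracle *)

Fixpoint oracle_subst (d c : code) : code :=
  match c with
  | Oracle => d
  | Pair c1 c2 => Pair (oracle_subst d c1) (oracle_subst d c2)
  | Comp c1 c2 => Comp (oracle_subst d c1) (oracle_subst d c2)
  | Prec c1 c2 => Prec (oracle_subst d c1) (oracle_subst d c2)
  | Rfind c1 => Rfind (oracle_subst d c1)
  | _ => c
  end.

Lemma eval_oracle_subst o o' d c n m :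
  computes d o' o -> eval o c n m -> eval o' (oracle_subst d c) n m.
Proof.
move=> o'd; elim=> {c n m} /=; try by [constructor | move=> n; exact: o'd].
- by move=> c c' n a a' _ IH _ IH'; apply: eval_comp IH IH'.
- by move=> c c' n i a a' _ IH _ IH'; apply: eval_precS IH IH'.
- by move=> c n k val _ IH _ IH'; apply: eval_rfind IH IH'.
Qed.

(** Primitive programs contain no oracle call, so the primitive recursive symbols of bounded
    formulas may be evaluated under any oracle. *)
Lemma eval_primitive o o' c n m : primitive c -> eval o c n m -> eval o' c n m.
Proof.
move=> + ev; elim: ev => {c n m} //=; try by constructor.
- by move=> c c' n a a' _ IH _ IH' /andP[/IH ? /IH' ?]; apply: eval_pair.
- move=> c c' n a a' _ IH _ IH' /andP[/IH' h' /IH h].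
  exact: eval_comp h h'.
- by move=> c c' n a _ IH /andP[/IH ? _]; apply: eval_prec0.
- move=> c c' n i a a' _ IH _ IH' /andP[pc pc'].
  by apply: eval_precS (IH' pc'); apply: IH; rewrite pc.
Qed.

Lemma ucomp_reindex I J (o : I -> nat -> nat) (o' : J -> nat -> nat) (j : J -> I) F :
  ucomp false o F -> ucomp false o' (fun i => o (j i)) ->
  ucomp false o' (fun i => F (j i)).
Proof.
move=> [c _ Fc] [d _ od]; exists (oracle_subst d c) => // i n.
by apply: eval_oracle_subst (Fc (j i) n) => m; apply: od.
Qed.

Lemma ucomp_oracle I (o : I -> nat -> nat) : ucomp false o o.
Proof. by exists Oracle => // i n; apply: eval_oracle. Qed.

Lemma ucomp_primrec I (o : I -> nat -> nat) f F :
  primrec f -> ucomp false o F -> ucomp false o (fun i n => f (F i n)).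
Proof.
case=> c pc fc; apply: (@ucomp_comp _ _ _ (fun=> f)); exists c => // i n.
exact: eval_primitive (fc n).
Qed.

Lemma computable_rel (alpha beta : nat -> nat) (c : code) :
  computable alpha -> computes c alpha beta -> computable beta.
Proof.
move=> [d dalpha] cbeta; exists (oracle_subst d c) => n.
exact: eval_oracle_subst (cbeta n).
Qed.

(** * Bounded formulas are uniformly decidable *)

(** The tuple [V i n] consists of bound variables, which are computed from [n],
    and of parameters read from the oracle [o i]. *)
Definition uenv I (o : I -> nat -> nat) (V : I -> nat -> seq value) : Prop :=
  (forall j, ucomp false o (fun i n => num (V i n) j)) /\
  (forall j, ucomp false o (fun i p => fn (V i (nfst p)) j (nsnd p))).

Lemma uenv_cons I (o : I -> nat -> nat) V T :
  uenv o V -> ucomp false o T ->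
  uenv o (fun i n => VNat (T i n) :: V i n).
Proof.
move=> [numV fnV] ucT; split=> -[|j]; rewrite ?/num ?/fn //=.
- exact: numV.
- exact: ucomp_const.
- exact: fnV.
Qed.

Lemma uenv_comp I (o : I -> nat -> nat) V T :
  uenv o V -> ucomp false o T -> uenv o (fun i n => V i (T i n)).
Proof.
move=> [numV fnV] ucT; split=> j; first exact: ucomp_comp (numV j) ucT.
apply: (ucomp_app2 (F := fun i n => fn (V i n) j) (fnV j)); last by ucomp_proj.
by apply: ucomp_comp ucT _; ucomp_proj.
Qed.

Lemma ucomp_strcode I (o : I -> nat -> nat) (f : I -> nat -> nat -> nat) T :
  ucomp false o (fun i p => f i (nfst p) (nsnd p)) -> ucomp false o T ->
  ucomp false o (fun i n => strcode (mkseq (f i n) (T i n))).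
Proof.
move=> ucf; pose H i n k := strcode (mkseq (f i n) k).
apply: (@ucomp_rec _ _ _ H (fun _ _ => 0) (fun i n k r => (npair r (f i n k)).+1)) => //.
- exact: ucomp_const.
- apply: ucomp_succ; apply: ucomp_npair; first by ucomp_proj.
  by apply: ucomp_app2 ucf _ _; ucomp_proj.
- by move=> i n k; rewrite /H /mkseq -addn1 iotaD map_cat /strcode foldl_cat.
Qed.

Lemma is_term_ucomp t : is_term t ->
  forall I (o : I -> nat -> nat) V, uenv o V -> ucomp false o (fun i n => t (V i n)).
Proof.
elim=> {t} [j|j t _ IH|j t _ IH|t u _ IHt _ IHu|f t fpr _ IH] I o V envV.
- exact: (proj1 envV).
- by apply: (ucomp_app2 (F := fun i n => fn (V i n) j) (proj2 envV j));
    [exact: ucomp_id | exact: IH].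
- apply: (ucomp_strcode (f := fun i n => fn (V i n) j)); last exact: IH.
  exact: (proj2 envV).
- by apply: ucomp_npair; [exact: IHt | exact: IHu].
- by apply: ucomp_primrec => //; apply: IH.
Qed.

Definition udecides I (o : I -> nat -> nat) (A : I -> nat -> Prop) : Prop :=
  exists2 P : I -> nat -> bool, ucomp false o (fun i n => P i n) &
  forall i n, P i n <-> A i n.

Lemma udecides_all I (o : I -> nat -> nat) (A : I -> nat -> nat -> Prop) T :
    udecides o (fun i p => A i (nfst p) (nsnd p)) -> ucomp false o T ->
  udecides o (fun i n => forall k, k < T i n -> A i n k).
Proof.
move=> [P ucP AP] ucT.
exists (fun i n => all (fun k => P i (npair n k)) (iota 0 (T i n))).
  apply: (ucomp_all (P := fun i n k => P i (npair n k))) => //.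
  by apply: ucomp_ext ucP _ => i p; rewrite npair_eta.
have APn i n k : P i (npair n k) <-> A i n k.
  by split=> [/AP | Ak]; [|apply/AP]; rewrite !npairE.
move=> i n; split=> [/allP allP k ltkT | allA].
  by apply/APn/allP; rewrite mem_iota.
by apply/allP => k; rewrite mem_iota => /allA /APn.
Qed.

Lemma udecides_not I (o : I -> nat -> nat) A :
  udecides o A -> udecides o (fun i n => ~ A i n).
Proof.
move=> [P ucP AP]; exists (fun i n => ~~ P i n) => [|i n]; first exact: ucomp_neg.
by split=> [/negP nP /AP | nA]; last by apply/negP => /AP.
Qed.

Lemma udecides_equiv I (o : I -> nat -> nat) A B :
  udecides o A -> (forall i n, A i n <-> B i n) -> udecides o B.
Proof. by move=> [P ucP AP] AB; exists P => // i n; rewrite AP. Qed.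

Lemma bounded_udecides A : bounded A ->
  forall I (o : I -> nat -> nat) V, uenv o V -> udecides o (fun i n => A (V i n)).
Proof.
have envS I (o : I -> nat -> nat) (V : I -> nat -> seq value) : uenv o V ->
    uenv o (fun i p => VNat (nsnd p) :: V i (nfst p)).
  by move=> envV; apply: uenv_cons; [apply: uenv_comp envV _|]; ucomp_proj.
elim=> {A} [t u ht hu|t u ht hu|A _ IH|A B _ IHA _ IHB|A B _ IHA _ IHB|
  t A ht _ IH|t A ht _ IH|A B _ IH AB] I o V envV.
- exists (fun i n => t (V i n) == u (V i n)) => [|i n].
    by apply: ucomp_eq; apply: is_term_ucomp.
  by split=> /eqP.
- exists (fun i n => t (V i n) < u (V i n)) => [|i n] //.
  by apply: ucomp_lt; apply: is_term_ucomp.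
- exact/udecides_not/IH.
- have [P ucP AP] := IHA I o V envV; have [Q ucQ BQ] := IHB I o V envV.
  exists (fun i n => P i n && Q i n) => [|i n]; first exact: ucomp_and.
  by rewrite -AP -BQ; split=> /andP.
- have [P ucP AP] := IHA I o V envV; have [Q ucQ BQ] := IHB I o V envV.
  exists (fun i n => P i n || Q i n) => [|i n]; first exact: ucomp_or.
  by rewrite -AP -BQ; split=> /orP.
- apply: (udecides_all (A := fun i n k => A (VNat k :: V i n))).
    exact: IH (envS _ _ _ envV).
  exact: is_term_ucomp.
- have dA := IH I o _ (envS _ _ _ envV).
  (* The bounded existential is decided as not-all-not; recovering its witness uses classical
     logic. *)
  have dN := udecides_all (A := fun i n k => ~ A (VNat k :: V i n))
    (udecides_not dA) (is_term_ucomp ht envV).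
  apply: udecides_equiv (udecides_not dN) _ => i n.
  split=> [nall | [k ltk Ak] /(_ k ltk)]; last by [].
  by apply: Classical_Prop.NNPP => nex; apply: nall => k ltk Ak; apply: nex; exists k.
- exact: udecides_equiv (IH I o V envV) _.
Qed.

(** * Decoding tuples and computability of instances *)

Lemma ucomp_enc_head I (o : I -> nat -> nat) s ss (x : I -> seq value) :
    (forall i, instance (s :: ss) (x i)) -> ucomp false o (fun i => enc (x i)) ->
  [/\ ucomp false o (fun i _ => num (x i) 0), ucomp false o (fun i => fn (x i) 0),
      forall i, instance ss (behead (x i))
    & ucomp false o (fun i => enc (behead (x i)))].
Proof.
move=> xss ucx; have uc_id := ucomp_id false o.
have [sE | hs] : s = SNat \/ (s = SBaire \/ s = SCantor) by case: (s); tauto.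
  have xE i : exists m v, x i = VNat m :: v.
    by have := xss i; rewrite sE; case: (x i) => [|[m|f] v] // _; exists m, v.
  split.
  - apply: ucomp_ext (ucomp_comp ucx (ucomp_const _ _ 0)) _ => i n.
    by have [m [v ->]] := xE i.
  - by apply: ucomp_ext (ucomp_const _ _ 0) _ => i n; have [m [v ->]] := xE i.
  - by move=> i; have := xss i; rewrite sE; have [m [v ->]] := xE i.
  - apply: ucomp_ext (ucomp_comp ucx (ucomp_succ uc_id)) _ => i n.
    by have [m [v ->]] := xE i.
have xE i : exists2 f, x i = VFun f :: behead (x i) & instance ss (behead (x i)).
  have := xss i.
  by case: hs => ->; case: (x i) => [|[m|f] v] //=; [case=> _ ? | case=> _ _ ?]; exists f.
have uc_num : ucomp false o (fun i _ => num (x i) 0).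
  by apply: ucomp_ext (ucomp_const _ _ 0) _ => i n; have [f ->] := xE i.
(* A function in last position is stored unjoined, so the layout depends on whether sorts remain;
   these are the same for all indices. *)
case: ss xss xE => [|s' ss'] xss xE; split=> //; try by move=> i; case: (xE i).
- apply: ucomp_ext ucx _ => i n.
  by case: (xE i) => f E; rewrite E /=; case: (behead (x i)).
- apply: ucomp_ext (ucomp_const _ _ 0) _ => i n.
  by case: (xE i) => f E; rewrite E /=; case: (behead (x i)).
- apply: ucomp_ext (ucomp_comp ucx (ucomp_add uc_id uc_id)) _ => i n.
  case: (xE i) => f E; rewrite E /=; case: (behead (x i)) => [|w v] /=.
    by case: (s').
  by move=> _; rewrite /fjoin addnn odd_double doubleK.
- apply: ucomp_ext (ucomp_comp ucx (ucomp_succ (ucomp_add uc_id uc_id))) _ => i n.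
  case: (xE i) => f E; rewrite E /=; case: (behead (x i)) => [|w v] /=.
    by case: (s').
  by move=> _; rewrite /fjoin addnn /= odd_double /= uphalf_double.
Qed.

Lemma uenv_enc I (o : I -> nat -> nat) ss (x : I -> seq value) :
  (forall i, instance ss (x i)) -> ucomp false o (fun i => enc (x i)) ->
  uenv o (fun i _ => x i).
Proof.
elim: ss x => [|s ss IH] x xss ucx.
  by split=> j; apply: ucomp_ext (ucomp_const _ _ 0) _ => i n;
     have := xss i; case: (x i) => // _; rewrite /num /fn nth_nil.
have [num0 fn0 xss' ucx'] := ucomp_enc_head xss ucx.
have [numS fnS] := IH _ xss' ucx'; split=> -[|j] //.
- by apply: ucomp_ext (numS j) _ => i n; rewrite /num nth_behead.
- by apply: ucomp_comp fn0 _; ucomp_proj.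
- by apply: ucomp_ext (fnS j) _ => i n; rewrite /fn nth_behead.
Qed.

Lemma ucomp_half I (o : I -> nat -> nat) T :
  ucomp false o T -> ucomp false o (fun i n => (T i n)./2).
Proof.
(* Half of [k + 1], rounded down, is [k] minus half of [k], rounded down. *)
apply: (@ucomp_rec _ _ _ (fun _ _ k => k./2) (fun _ _ => 0) (fun _ _ k r => k - r)) => //.
- exact: ucomp_const.
- by apply: ucomp_sub; ucomp_proj.
- by move=> _ _ k; lia.
Qed.

Lemma ucomp_odd I (o : I -> nat -> nat) T :
  ucomp false o T -> ucomp false o (fun i n => odd (T i n)).
Proof.
move=> ucT; have ucT2 := ucomp_half ucT.
apply: ucomp_ext (ucomp_sub ucT (ucomp_add ucT2 ucT2)) _ => i n; lia.
Qed.

Lemma computable_fcons m f : computable f -> computable (fcons m f).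
Proof.
move=> [c cf]; have ucf : ucomp false (fun (_ : unit) _ => 0) (fun _ => f) by exists c.
suff [d _ df] : ucomp false (fun (_ : unit) _ => 0) (fun _ n => fcons m f n).
  by exists d; apply: (df tt).
apply: (ucomp_fcons (E := fun _ _ => f)); [exact: ucomp_const | | exact: ucomp_id].
by apply: (ucomp_comp (F := fun _ => f)) => //; ucomp_proj.
Qed.

Lemma computable_fjoin f g : computable f -> computable g -> computable (fjoin f g).
Proof.
move=> [c cf] [d dg].
have ucf : ucomp false (fun (_ : unit) _ => 0) (fun _ => f) by exists c.
have ucg : ucomp false (fun (_ : unit) _ => 0) (fun _ => g) by exists d.
have uc_id := ucomp_id false (fun (_ : unit) _ => 0).
have [e _ eP] := ucomp_if (ucomp_odd uc_id) (ucomp_comp ucg (ucomp_half uc_id))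
  (ucomp_comp ucf (ucomp_half uc_id)).
by exists e; apply: (eP tt).
Qed.

Lemma instance_computable ss x : instance ss x -> computable (enc x).
Proof.
elim: ss x => [|s ss IH] [|[m|f] x] //; try by case: s.
- by move=> _; exists Zero => n; apply: eval_zero.
- by case: s => //= /IH; apply: computable_fcons.
have fnE : computable f -> instance ss x -> computable (enc (VFun f :: x)).
  by move=> compf /IH; case: x => // w x; apply: computable_fjoin.
by case: s => //; [case; exact: fnE | case=> ? _; exact: fnE].
Qed.

(** * The matrix of [SimpNormal] *)

(** With [c] ones among [t] bits the condition is [|2c - t| (k + 1) <= 2t], split in two by
    truncated subtraction. For [t = 0] the frequency is 0 by the convention on division, and
    [1/2 <= 1/(k + 1)] means [k < 2]. *)
Definition balanced (c t k : nat) : bool :=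
  [&& (0 < t) || (k < 2), (c.*2 - t) * k.+1 <= t.*2 & (t - c.*2) * k.+1 <= t.*2].

Lemma freq1_balanced s k :
  (`|freq1 s - 1 / 2%:R| <= 1 / (k.+1)%:R)%R = balanced (count (pred1 1) s) (size s) k.
Proof.
rewrite /freq1 /balanced; move: (count _ _) (size s) (count_size (pred1 1) s) => c t ct.
have k0 : (0 < (k.+1)%:R :> rat)%R by rewrite ltr0n.
have [t0|t0] := eqVneq t 0.
  rewrite t0 invr0 mulr0 sub0r normrN ger0_norm ?divr_ge0 ?ler0n // subn0 sub0n andbT.
  rewrite ler_pdivrMr ?ltr0n // mulrAC mul1r ler_pdivlMr // mul1r ler_nat.
  by move: ct; rewrite t0 leqn0 => /eqP ->; rewrite andbT.
rewrite lt0n t0 /=; have t0' : (0 < t%:R :> rat)%R by rewrite ltr0n lt0n.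
have q0 : (0 < (2%:R * t%:R * k.+1%:R)^-1 :> rat)%R.
  by rewrite invr_gt0 !mulr_gt0 ?ltr0n ?lt0n.
(* Both inequalities are compared over the common denominator [2 t (k + 1)]. *)
have rat_le (a b : nat) (u v : rat) :
    (u - v = (a%:R - b%:R) * (2%:R * t%:R * k.+1%:R)^-1)%R -> (u <= v)%R = (a <= b).
  by move=> uv; rewrite -subr_le0 uv (pmulr_lle0 _ q0) subr_le0 ler_nat.
have t_neq0 : (t%:R != 0 :> rat)%R by rewrite gt_eqF.
have k_neq0 : (k.+1%:R != 0 :> rat)%R by rewrite gt_eqF.
rewrite ler_norml andbC !mulnBl !leq_subLR; congr (_ && _); apply: rat_le;
by rewrite natrD !natrM -!muln2 !natrM; field; rewrite nat1r k_neq0.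
Qed.

(** [r] codes a string that remains to be read, from its end, and the number of
    ones seen so far. *)
Definition ones_step (r : nat) : nat :=
  npair (nfst (nfst r).-1) (nsnd r + (nsnd (nfst r).-1 == 1)).

Lemma ones_step_strcode s w m :
  iter (size w) ones_step (npair (strcode (s ++ w)) m) =
  npair (strcode s) (m + count (pred1 1) w).
Proof.
elim: w s => [|a w IH] s /=; first by rewrite cats0 addn0.
rewrite -cat_rcons IH /ones_step !npairE /strcode foldl_rcons /= !npairE.
by congr npair; lia.
Qed.

(** Function symbols of bounded formulas are unary, so string code, length and [k] are packed into
    one number. *)
Definition balanced_code (w : nat) : bool :=
  let s := nfst w in let t := nfst (nsnd w) in let k := nsnd (nsnd w) in
  balanced (nsnd (iter t ones_step (npair s 0))) t k.

Lemma balanced_codeE s k :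
  balanced_code (npair (strcode s) (npair (size s) k)) =
  balanced (count (pred1 1) s) (size s) k.
Proof. by rewrite /balanced_code !npairE (ones_step_strcode [::]) !npairE. Qed.

Lemma primrec_balanced_code : primrec balanced_code.
Proof.
suff [c pc cP] : ucomp true (fun (_ : unit) _ => 0) (fun _ w => balanced_code w).
  by exists c => //; apply: (cP tt).
rewrite /balanced_code /balanced; set o := fun _ _ => 0.
have uc_t : ucomp true o (fun _ w => nfst (nsnd w)) by ucomp_proj.
have uc_k : ucomp true o (fun _ w => nsnd (nsnd w)) by ucomp_proj.
have uc_double F : ucomp true o F -> ucomp true o (fun i w => (F i w).*2).
  by move=> ucF; apply: ucomp_ext (ucomp_add ucF ucF) _ => i n; rewrite addnn.
have uc_c : ucomp true o (fun _ w =>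
    nsnd (iter (nfst (nsnd w)) ones_step (npair (nfst w) 0))).
  apply: ucomp_nsnd.
  apply: (@ucomp_rec _ _ _ (fun _ w k => iter k ones_step (npair (nfst w) 0))
   (fun _ w => npair (nfst w) 0) (fun _ _ _ r => ones_step r)) => //.
  - by apply: ucomp_npair; [ucomp_proj | exact: ucomp_const].
  - apply: ucomp_npair; first by apply: ucomp_nfst; apply: ucomp_pred; ucomp_proj.
    apply: ucomp_add; first by ucomp_proj.
    apply: ucomp_eq; last exact: ucomp_const.
    by apply: ucomp_nsnd; apply: ucomp_pred; ucomp_proj.
have uc_le F : ucomp true o F -> ucomp true o (fun i w =>
    F i w * (nsnd (nsnd w)).+1 <= (nfst (nsnd w)).*2).
  move=> ucF; apply: ucomp_le; last exact: uc_double.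
  by apply: ucomp_mul => //; apply: ucomp_succ.
apply: (ucomp_and (P := fun _ w => _) (Q := fun _ w => _)).
  apply: (ucomp_or (P := fun _ w => _) (Q := fun _ w => _)); apply: ucomp_lt => //;
  exact: ucomp_const.
by apply: (ucomp_and (P := fun _ w => _) (Q := fun _ w => _)); apply: uc_le;
  apply: ucomp_sub => //; apply: uc_double.
Qed.

Lemma bounded_SimpNormal : bounded (matrix SimpNormal).
Proof.
have prim0 : primrec (fun=> 0) by exists Zero => // n; apply: eval_zero.
(* The matrix becomes [0 < balanced_code <x|t, <t, k>>]; the constant 0 is the zero function applied
   to a variable. *)
apply: (bounded_equiv (bounded_lt (term_prim prim0 (term_var 0))
  (term_prim primrec_balanced_code
    (term_pair (term_seg 2 (term_var 0)) (term_pair (term_var 0) (term_var 1)))))) => v.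
rewrite /= freq1_balanced -balanced_codeE size_mkseq.
by case: balanced_code.
Qed.

(** * The wave of a labelling *)

Section Wave.
Context (lab : nat -> nat).

(** The state before time [t] consists of the stage, of the bit to be emitted, and
    of the excess of ones over zeros among the bits [0, .., t - 1]. *)
Definition wave_step (r : nat * (bool * nat)) (t : nat) : nat * (bool * nat) :=
  let: (n, (up, d)) := r in
  if up then (n, (d.+1 * (lab n).+2 <= t.+1, d.+1))
  else if d <= 1 then (n.+1, (true, 0)) else (n, (false, d.-1)).

Fixpoint wave (t : nat) : nat * (bool * nat) :=
  if t is t'.+1 then wave_step (wave t') t' else (0, (true, 0)).

Definition stage t := (wave t).1.
Definition rising t := (wave t).2.1.
Definition excess t := (wave t).2.2.
Definition wave_seq t : nat := rising t.

Lemma waveE t : wave t = (stage t, (rising t, excess t)).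
Proof. by rewrite /stage /rising /excess; case: (wave t) => n []. Qed.

Lemma wave_rec t :
  wave t.+1 = wave_step (stage t, (rising t, excess t)) t.
Proof. by rewrite /= waveE. Qed.

(** Ones are added only while the excess is within its threshold, so a peak overshoots by at most
    one, whence the predecessor. A new stage starts with excess 0, so the change of label is
    harmless. *)
Lemma wave_inv t :
  [/\ if rising t then excess t * (lab (stage t)).+2 <= t else 0 < excess t,
      (excess t).-1 * (lab (stage t)).+2 <= t & stage t <= t].
Proof.
elim: t => [//|t]; move: (wave_rec t); rewrite [X in X = _]waveE /=.
case: (rising t); last case: (leqP (excess t) 1) => ?; case=> -> -> -> [] *;
  split=> //; first [by case: ifP | nia].
Qed.

(** In a falling phase the excess is positive, so each zero lowers it by exactly one, also when the
    stage ends. *)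
Lemma wave_count t : (count (pred1 1) (mkseq wave_seq t)).*2 = t + excess t.
Proof.
elim: t => // t IH; rewrite mkseqS -cats1 count_cat doubleD IH /wave_seq.
have [inv _ _] := wave_inv t; move: (wave_rec t) inv; rewrite [X in X = _]waveE /=.
case: (rising t); last case: (leqP (excess t) 1) => ?; case=> _ _ -> /=; lia.
Qed.

Lemma stage_mono t u : t <= u -> stage t <= stage u.
Proof.
elim: u => [|u IH]; first by case: t.
rewrite leq_eqVlt => /orP[/eqP-> // | /IH le_tu]; apply: leq_trans le_tu _.
move: (wave_rec u); rewrite [X in X = _]waveE /=.
by case: (rising u); last case: (leqP (excess u) 1) => ?; case=> -> _ _.
Qed.

(** Each one raises the left side of the threshold by [lab + 2] and the right side by 1, so the gap
    used as measure shrinks until the threshold is passed. *)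
Lemma wave_peak t : rising t ->
  exists u, [/\ t < u, stage u = stage t, ~~ rising u
    & u < excess u * (lab (stage u)).+2].
Proof.
have [m] := ubnP (t.+1 - excess t * (lab (stage t)).+2); elim: m t => // m IH t ltm upt.
have := wave_inv t; rewrite upt => -[inv _ _].
move: (wave_rec t); rewrite [X in X = _]waveE upt /=.
case: (leqP ((excess t).+1 * (lab (stage t)).+2) t.+1) => lt; case=> sE uE eE; last first.
  by exists t.+1; rewrite sE uE eE; split.
have [||u [ltu suE nup pk]] := IH t.+1; rewrite ?sE ?uE ?eE //; first by nia.
by exists u; split=> //; [exact: ltnW | rewrite suE].
Qed.

Lemma wave_fall t : ~~ rising t ->
  exists u, [/\ t < u, stage u = (stage t).+1 & rising u].
Proof.
have [m] := ubnP (excess t); elim: m t => // m IH t ltm nup.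
move: (wave_rec t); rewrite [X in X = _]waveE (negPf nup) /=.
case: (leqP (excess t) 1) => lt; case=> sE uE eE.
  by exists t.+1; rewrite sE uE; split.
have [||u [ltu suE upu]] := IH t.+1; rewrite ?uE ?eE //; first by lia.
by exists u; split=> //; [exact: ltnW | rewrite suE sE].
Qed.

Lemma wave_rise n : exists t, stage t = n /\ rising t.
Proof.
elim: n => [|n [t [<- upt]]]; first by exists 0.
have [u [_ <- /wave_fall[t' [_ sE upt']] _]] := wave_peak upt.
by exists t'.
Qed.

Lemma stage_unbounded n : exists t, n <= stage t.
Proof. by have [t [<- _]] := wave_rise n; exists t. Qed.

(** The peak lies within stage [n], and a stage number never exceeds the time. *)
Lemma wave_peak_stage n : exists2 t, n <= t & t < excess t * (lab n).+2.
Proof.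
have [t [stn /wave_peak[u [_ suE _ pk]]]] := wave_rise n; rewrite -stn.
by exists u; [have [_ _] := wave_inv u; rewrite suE | rewrite -suE].
Qed.

(** The invariant bounds [(excess - 1)(k + 1)] by [t]; the overshoot adds at most [k + 1 <= t]. *)
Lemma wave_balanced k t : k <= lab (stage t) -> k < t -> excess t * k.+1 <= t.*2.
Proof. by move=> lek ltk; have [_ inv _] := wave_inv t; nia. Qed.

(** Ones never fall behind zeros, so only deviations upwards remain. *)
Lemma balanced_wave t k : 0 < t ->
  balanced (count (pred1 1) (mkseq wave_seq t)) t k = (excess t * k.+1 <= t.*2).
Proof.
move=> t0; rewrite /balanced t0 wave_count /=.
by rewrite addKn (eqP (leq_addr _ _)) mul0n andbT.
Qed.

Lemma SimpNormal_wave t k : 0 < t ->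
  matrix SimpNormal [:: VNat t; VNat k; VFun wave_seq] <-> excess t * k.+1 <= t.*2.
Proof.
move=> t0; rewrite /= freq1_balanced size_mkseq balanced_wave //.
Qed.

End Wave.

(** States become numbers so that [wave] is computed by primitive recursion on codes. *)
Definition wave_code (r : nat * (bool * nat)) : nat :=
  npair r.1 (npair r.2.1 r.2.2).

Lemma ucomp_wave I (o : I -> nat -> nat) (lab : I -> nat -> nat) :
  ucomp false o lab ->
  [/\ ucomp false o (fun i => stage (lab i)), ucomp false o (fun i => excess (lab i))
    & ucomp false o (fun i => wave_seq (lab i))].
Proof.
move=> uclab.
have uc : ucomp false o (fun i t => wave_code (wave (lab i) t)).
  pose H i (_ t r : nat) := let n := nfst r in let up := nfst (nsnd r) in
    let d := nsnd (nsnd r) in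
    if up == 1 then npair n (npair (d.+1 * (lab i n).+2 <= t.+1) d.+1)
    else if d <= 1 then npair n.+1 (npair 1 0) else npair n (npair 0 d.-1).
  apply: (@ucomp_rec _ _ _ (fun i _ t => wave_code (wave (lab i) t))
    (fun _ _ => npair 0 (npair 1 0)) H) => //.
  - exact: ucomp_const.
  - set n := fun p => nfst (nsnd (nsnd p)).
    set up := fun p => nfst (nsnd (nsnd (nsnd p))).
    set d := fun p => nsnd (nsnd (nsnd (nsnd p))).
    have ucn : ucomp false o (fun _ p => n p) by ucomp_proj.
    have ucup : ucomp false o (fun _ p => up p) by ucomp_proj.
    have ucd : ucomp false o (fun _ p => d p) by ucomp_proj.
    rewrite /H -/(n _).
    apply: (ucomp_if (P := fun _ p => up p == 1)).
      by apply: ucomp_eq => //; apply: ucomp_const.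
    + apply: ucomp_npair => //; apply: ucomp_npair; last exact: ucomp_succ.
      apply: ucomp_le; last by apply: ucomp_succ; ucomp_proj.
      apply: ucomp_mul; [exact: ucomp_succ | do 2!apply: ucomp_succ].
      exact: ucomp_comp uclab ucn.
    + apply: (ucomp_if (P := fun _ p => d p <= 1)).
        by apply: ucomp_le => //; apply: ucomp_const.
      * by apply: ucomp_npair; [exact: ucomp_succ | exact: ucomp_const].
      * by do 2!apply: ucomp_npair => //; [exact: ucomp_const | exact: ucomp_pred].
  - move=> i s t; rewrite /H /wave_code /= !npairE /=.
    by case: (wave _ t) => m [[] e] //=; case: leqP.
  - exact: ucomp_id.
split.
- by apply: ucomp_ext (ucomp_nfst uc) _ => i t; rewrite /wave_code !npairE.
- by apply: ucomp_ext (ucomp_nsnd (ucomp_nsnd uc)) _ => i t; rewrite /wave_code !npairE.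
- by apply: ucomp_ext (ucomp_nfst (ucomp_nsnd uc)) _ => i t; rewrite /wave_code !npairE.
Qed.

(** * Witnesses *)

(** Built from a modulus [S]: the section at [a] holds [S a] and then, for each [n], the code of the
    tuple [(n, a, x)] demanded by the matrix, [E] being the code of [x]. *)
Definition all_allinf_wit (S E : nat -> nat) : nat -> nat := fun p =>
  fcons (S (nfst p)) (fun j => fcons (nfst j) (fcons (nfst p) E) (nsnd j)) (nsnd p).

(** [K m] occurs twice: as the number chosen beyond [m], and as the head of the encoded tuple. *)
Definition ex_exinf_wit (a : nat) (K E : nat -> nat) : nat -> nat :=
  fcons a (fun p => fcons (K (nfst p)) (fcons (K (nfst p)) (fcons a E)) (nsnd p)).

Lemma wit_all_allinf theta v alpha :
  wit [:: QAll; QAllInf] theta v alpha ->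
  forall a n, alpha (npair a 0) <= n -> theta (VNat n :: VNat a :: v).
Proof. by move=> w a n /(w a n) [_]. Qed.

Lemma wit_all_allinfI (theta : seq value -> Prop) v S :
  (forall a n, S a <= n -> theta (VNat n :: VNat a :: v)) ->
  wit [:: QAll; QAllInf] theta v (all_allinf_wit S (enc v)).
Proof.
move=> ST a n; rewrite /all_allinf_wit /section !npairE /= => leSn; split; last exact: ST.
by move=> i; rewrite /ftail !npairE /= !npairE.
Qed.

Lemma wit_ex_exinf theta v alpha :
  wit [:: QEx; QExInf] theta v alpha ->
  forall m, exists2 n, m <= n & theta (VNat n :: VNat (alpha 0) :: v).
Proof.
by move=> w m; case: (w m) => lem [_ tn]; exists (section (ftail alpha) m 0).
Qed.

Lemma wit_ex_exinfI (theta : seq value -> Prop) v a K :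
  (forall m, m <= K m /\ theta (VNat (K m) :: VNat a :: v)) ->
  wit [:: QEx; QExInf] theta v (ex_exinf_wit a K (enc v)).
Proof.
move=> KT m; rewrite /ex_exinf_wit /section /ftail /= !npairE /=.
have [lem tK] := KT m; split=> //; split=> // i.
by rewrite !npairE.
Qed.

Section WitComputable.
Context (I : Type) (o : I -> nat -> nat).
Implicit Types (S E K : I -> nat -> nat) (a : I -> nat).

Lemma ucomp_tag2 (F G E : I -> nat -> nat) T :
  ucomp false o F -> ucomp false o G -> ucomp false o E -> ucomp false o T ->
  ucomp false o (fun i n => fcons (F i n) (fcons (G i n) (E i)) (T i n)).
Proof.
move=> ucF ucG ucE ucT.
apply: (ucomp_fcons (E := fun i n => fcons (G i n) (E i))) => //.
apply: (ucomp_fcons (F := fun i p => G i (nfst p)) (E := fun i _ => E i)).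
- by apply: (ucomp_comp ucG); ucomp_proj.
- by apply: (ucomp_comp ucE); ucomp_proj.
- by ucomp_proj.
Qed.

Lemma ucomp_all_allinf_wit S E : ucomp false o S -> ucomp false o E ->
  ucomp false o (fun i => all_allinf_wit (S i) (E i)).
Proof.
move=> ucS ucE.
apply: (ucomp_fcons (F := fun i p => S i (nfst p))
  (E := fun i p j => fcons (nfst j) (fcons (nfst p) (E i)) (nsnd j))).
- by apply: (ucomp_comp ucS); ucomp_proj.
- by apply: ucomp_tag2 => //; ucomp_proj.
- by ucomp_proj.
Qed.

Lemma ucomp_ex_exinf_wit a K E :
  ucomp false o (fun i _ => a i) -> ucomp false o K -> ucomp false o E ->
  ucomp false o (fun i => ex_exinf_wit (a i) (K i) (E i)).
Proof.
move=> uca ucK ucE.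
apply: (ucomp_fcons (F := fun i p => a i) (E := fun i _ p =>
  fcons (K i (nfst p)) (fcons (K i (nfst p)) (fcons (a i) (E i))) (nsnd p)));
  [by [] | | exact: ucomp_id].
have ucK' : ucomp false o (fun i p => K i (nfst (nsnd p))).
  by apply: (ucomp_comp ucK); ucomp_proj.
apply: (ucomp_fcons (F := fun i p => K i (nfst (nsnd p))) (E := fun i p =>
  fcons (K i (nfst (nsnd p))) (fcons (a i) (E i)))) => //; last by ucomp_proj.
apply: (ucomp_tag2 (F := fun i p => K i (nfst (nsnd (nfst p))))
  (G := fun i _ => a i)) => //; last by ucomp_proj.
by apply: (ucomp_comp ucK); ucomp_proj.
Qed.

End WitComputable.

Lemma reduces_via_refl phi : reduces_via Oracle phi phi.
Proof.
have [c _ cP] : ucomp false (fun o : nat -> nat => o) (fun o n => o (n + n)).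
  by apply: (ucomp_comp (ucomp_oracle _)); apply: ucomp_add; ucomp_proj.
have cfst alpha beta : computes c (fjoin alpha beta) alpha.
  by move=> n; move: (cP (fjoin alpha beta) n); rewrite /fjoin addnn odd_double doubleK.
exists c, c => x ssx; exists x; split=> //; first by move=> n; apply: eval_oracle.
- by move=> alpha w; exists alpha.
- by move=> alpha w; exists alpha.
Qed.

Lemma le_dm_refl phi : le_dm phi phi.
Proof. by exists Oracle; split; apply: reduces_via_refl. Qed.

(** * Labels and eventual bounds *)

Lemma eventually_below (P : nat -> nat -> Prop) k :
  (forall a, a < k -> exists t, forall n, t <= n -> P a n) ->
  exists T, forall a n, a < k -> T <= n -> P a n.
Proof.
elim: k => [|k IH] ev; first by exists 0.
have [|T TP] := IH; first by move=> a ltak; apply: ev; apply: ltnW.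
have [t tP] := ev k (leqnn _); exists (maxn T t) => a n.
rewrite ltnS leq_eqVlt geq_max => /orP[/eqP-> | ltak] /andP[leT let_].
  exact: tP.
exact: TP.
Qed.

Definition label (D : nat -> nat -> bool) (n : nat) : nat :=
  find (fun a => ~~ D n a) (iota 0 n).

Lemma label_le D n a : a <= n -> ~~ D n a -> label D n <= a.
Proof.
rewrite leq_eqVlt => /orP[/eqP-> _ | ltan nD].
  by rewrite -{2}(size_iota 0 n) find_size.
rewrite leqNgt; apply/negP => /(before_find 0).
by rewrite nth_iota // nD.
Qed.

Lemma label_bad D n : label D n < n -> ~~ D n (label D n).
Proof.
move=> lt; have := @nth_find _ 0 (fun a => ~~ D n a) (iota 0 n).
by rewrite has_find size_iota nth_iota => //; apply.
Qed.

Lemma le_label (D : nat -> nat -> bool) n k :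
  k <= n -> (forall a, a < k -> D n a) -> k <= label D n.
Proof.
move=> lekn Dk; rewrite leqNgt; apply/negP => ltlk.
by have := label_bad (leq_trans ltlk lekn); rewrite Dk.
Qed.

(** * The reduction *)

Section LabelWave.
Context (D : nat -> nat -> bool).
Let lab := label D.

(** From stage [T] on no label is below [k]: the failures of all [a < k] are over, and [k <= T]
    keeps the default label, the stage itself, from being smaller. *)
Lemma label_wave_balanced k T s t :
  (forall a n, a < k -> T <= n -> D n a) -> k <= T -> T <= stage lab s ->
  k < t -> s <= t -> excess lab t * k.+1 <= t.*2.
Proof.
move=> DT lekT leTs ltkt lest; apply: wave_balanced => //.
have leTt := leq_trans leTs (stage_mono lab lest).
by apply: le_label => [|a ltak]; [exact: leq_trans lekT leTt | exact: DT].
Qed.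

(** The label is at most [a], so the peak of stage [n] satisfies [t < excess (a + 2)]. Doubling
    gives the tolerance index [k = 2a + 3], for which [k + 1 = 2(a + 2)]. *)
Lemma label_wave_peak a n : a <= n -> ~~ D n a ->
  exists t, [/\ 0 < t, n <= t & t.*2 < excess lab t * (a.*2.+3).+1].
Proof.
move=> lean nD; have [t lent pk] := wave_peak_stage lab n; exists t; split=> //.
  by case: (t) pk.
by have := label_le lean nD; rewrite -/lab; nia.
Qed.

(** A large deviation forces a label below [k], hence below the stage, so it is a genuine failure
    and not the default. *)
Lemma label_wave_bad k t : k < t -> k <= stage lab t ->
  t.*2 < excess lab t * k.+1 ->
  exists2 a, a < k & ~~ D (stage lab t) a.
Proof.
move=> ltkt lekn pk; have ltlk : lab (stage lab t) < k.
  by rewrite ltnNge; apply/negP => /wave_balanced/(_ ltkt); rewrite leqNgt pk.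
by exists (lab (stage lab t)) => //; apply: label_bad; apply: leq_trans lekn.
Qed.

End LabelWave.

Lemma all_allinf_wave (D : nat -> nat -> bool) :
  (forall a, exists t, forall n, t <= n -> D n a) <->
  forall k, exists s, forall t, s <= t -> excess (label D) t * k.+1 <= t.*2.
Proof.
split=> [Dev k | bal a].
  have [|T DT] := @eventually_below (fun a n => D n a) k; first by move=> a _.
  have [s les] := stage_unbounded (label D) (maxn k T).
  exists (maxn k.+1 s) => t; rewrite geq_max => /andP[ltkt lest].
  apply: (label_wave_balanced (T := maxn k T)) les ltkt lest => [a n ltak|].
    by rewrite geq_max => /andP[_]; apply: DT.
  exact: leq_maxl.
have [s sP] := bal a.*2.+3; exists (maxn s a) => n; rewrite geq_max => /andP[lesn lean].
apply: contraT => /(label_wave_peak lean)[t [_ lent]].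
by rewrite ltnNge sP // (leq_trans lesn).
Qed.

(** If failures at [k] stopped, the descending hypothesis would stop them at every [a < k], and the
    deviations would end. So [k] itself works and no [a < k] has to be guessed. *)
Lemma ex_exinf_wave_bad (D : nat -> nat -> bool) k :
    (forall a, a <= k -> (exists t, forall n, t <= n -> D n k) ->
       exists t, forall n, t <= n -> D n a) ->
    (forall m, exists2 t, m <= t & t.*2 < excess (label D) t * k.+1) ->
  forall m, exists n, (m <= n) && ~~ D n k.
Proof.
move=> desc pk m; apply: Classical_Prop.NNPP => nex.
have evk : exists t, forall n, t <= n -> D n k.
  by exists m => n lemn; apply: contraT => nD; case: nex; exists n; rewrite lemn.
have [|T DT] := @eventually_below (fun a n => D n a) k.
  by move=> a ltak; apply: desc evk; apply: ltnW.
have [s les] := stage_unbounded (label D) (maxn k T).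
have [t] := pk (maxn k.+1 s); rewrite geq_max => /andP[ltkt lest].
have := leq_trans les (stage_mono _ lest); rewrite geq_max => /andP[lek leT] lt.
by have [a ltak] := label_wave_bad ltkt lek lt; rewrite DT.
Qed.

(** * Realizers uniform in instance and witness *)

Definition instances (ss : seq sort) : Type := {x | instance ss x}.

Definition instance_oracle ss (i : instances ss) : nat -> nat := enc (sval i).

Definition witnessed ss (W : instances ss -> (nat -> nat) -> Prop) : Type :=
  {p : instances ss * (nat -> nat) | W p.1 p.2}.

Definition woracle ss (W : instances ss -> (nat -> nat) -> Prop) (p : witnessed W) :
    nat -> nat :=
  fjoin (sval p).2 (instance_oracle (sval p).1).

Lemma uniform_realizer ss (W V : instances ss -> (nat -> nat) -> Prop)
    (F : witnessed W -> nat -> nat) :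
    ucomp false (@woracle ss W) F -> (forall p, V (sval p).1 (F p)) ->
  exists r, forall i alpha, W i alpha ->
    exists2 beta, computes r (fjoin alpha (instance_oracle i)) beta & V i beta.
Proof.
move=> [r _ rF] FV; exists r => i alpha w.
pose p : witnessed W := exist (fun p => W p.1 p.2) (i, alpha) w.
by exists (F p); [exact: (rF p) | exact: (FV p)].
Qed.

Lemma ucomp_instance ss (W : instances ss -> (nat -> nat) -> Prop) F :
  ucomp false (@instance_oracle ss) F ->
  ucomp false (@woracle ss W) (fun p => F (sval p).1).
Proof.
move=> ucF; apply: ucomp_reindex ucF _; have uc_id := ucomp_id false (@woracle ss W).
apply: ucomp_ext (ucomp_comp (ucomp_oracle _) (ucomp_succ (ucomp_add uc_id uc_id))) _.
by move=> p n; rewrite /woracle /fjoin addnn /= odd_double /= uphalf_double.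
Qed.

Lemma ucomp_witness ss (W : instances ss -> (nat -> nat) -> Prop) :
  ucomp false (@woracle ss W) (fun p => (sval p).2).
Proof.
have uc_id := ucomp_id false (@woracle ss W).
apply: ucomp_ext (ucomp_comp (ucomp_oracle _) (ucomp_add uc_id uc_id)) _.
by move=> p n; rewrite /woracle /fjoin addnn odd_double doubleK.
Qed.

Section Reduction.
Context (ss : seq sort) (theta : seq value -> Prop).
Let inst : Type := instances ss.
Let oracle : inst -> nat -> nat := @instance_oracle ss.
Context (D : inst -> nat -> nat -> bool).
Context (ucD : ucomp false oracle (fun i p => D i (nfst p) (nsnd p))).
Context (DE : forall i n a, D i n a <-> theta [:: VNat n, VNat a & sval i]).
Context (desc : descending (Formula [:: QAllInf] (SNat :: ss) theta)).

Let lab (i : inst) : nat -> nat := label (D i).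
Let y (i : inst) : seq value := [:: VFun (wave_seq (lab i))].

Let ucomp_lab : ucomp false oracle lab.
Proof.
apply: (ucomp_find (P := fun i n a => ~~ D i n a)); last exact: ucomp_id.
exact: (ucomp_neg (P := fun i p => D i (nfst p) (nsnd p))).
Qed.

Let descD i k a : a <= k -> (exists t, forall n, t <= n -> D i n k) ->
  exists t, forall n, t <= n -> D i n a.
Proof.
move=> leak [t tP].
have [||t' t'P] := desc (x := sval i) _ leak; first exact: (proj2_sig i).
  by exists t => n /tP /DE.
by exists t' => n /t'P /DE.
Qed.

(** At [t = 0] the inequality holds trivially while the matrix fails for [k >= 2]; hence the
    positivity hypothesis. *)
Let SNE i t k : 0 < t ->
  matrix SimpNormal [:: VNat t, VNat k & y i] <-> excess (lab i) t * k.+1 <= t.*2.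
Proof. exact: SimpNormal_wave. Qed.

Let not_SNE i t k : 0 < t ->
  ~ matrix SimpNormal [:: VNat t, VNat k & y i] <-> t.*2 < excess (lab i) t * k.+1.
Proof. by move=> t0; rewrite SNE // ltnNge; split=> /negP. Qed.

Let not_DE i n a : ~~ D i n a <-> ~ theta [:: VNat n, VNat a & sval i].
Proof. by rewrite -DE; split=> /negP. Qed.

Let ucomp_seq : ucomp false oracle (fun i => wave_seq (lab i)).
Proof. by case: (ucomp_wave ucomp_lab). Qed.

Let ucomp_excess : ucomp false oracle (fun i => excess (lab i)).
Proof. by case: (ucomp_wave ucomp_lab). Qed.

Let ucomp_stage : ucomp false oracle (fun i => stage (lab i)).
Proof. by case: (ucomp_wave ucomp_lab). Qed.

Let all_wit (i : inst) := wit [:: QAll; QAllInf] theta (sval i).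
Let all_witSN (i : inst) := wit [:: QAll; QAllInf] (matrix SimpNormal) (y i).
Let ex_wit (i : inst) := wit [:: QEx; QExInf] (fun v => ~ theta v) (sval i).
Let ex_witSN (i : inst) := wit [:: QEx; QExInf] (fun v => ~ matrix SimpNormal v) (y i).

Lemma realizer_all : exists r, forall i alpha, all_wit i alpha ->
  exists2 beta, computes r (fjoin alpha (oracle i)) beta & all_witSN i beta.
Proof.
(* The sum exceeds each of the [k] given bounds, and its added ones make it at least [k];
   [label_wave_balanced] needs both. *)
pose T (p : witnessed all_wit) k := \sum_(a < k) ((sval p).2 (npair a 0)).+1.
have leT p a k : a < k -> (sval p).2 (npair a 0) < T p k.
  by move=> ltak; rewrite /T (bigD1 (Ordinal ltak)) //= leq_addr.
have leTk p k : k <= T p k.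
  by rewrite -[leqLHS](card_ord k) -sum1_card; apply: leq_sum.
pose s p k := ex_minn (stage_unbounded (lab (sval p).1) (T p k)).
pose S p k := maxn k.+1 (s p k).
apply: (uniform_realizer (F := fun p => all_allinf_wit (S p) (enc (y (sval p).1)))).
  apply: ucomp_all_allinf_wit; last exact: (ucomp_instance _ ucomp_seq).
  apply: ucomp_max; first by apply: ucomp_succ; apply: ucomp_id.
  apply: (ucomp_search (P := fun p k t => T p k <= stage (lab (sval p).1) t)).
  apply: ucomp_le.
    apply: (@ucomp_rec _ _ _ (fun p _ k => T p k) (fun _ _ => 0)
      (fun p _ k r => r + ((sval p).2 (npair k 0)).+1)) => //.
    + exact: ucomp_const.
    + apply: ucomp_add; first by ucomp_proj.
      apply: ucomp_succ; apply: (ucomp_comp (ucomp_witness _)).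
      by apply: ucomp_npair; [ucomp_proj | exact: ucomp_const].
    + by move=> p _; rewrite /T big_ord0.
    + by move=> p n k; rewrite /T big_ord_recr.
    + by ucomp_proj.
  by apply: (ucomp_comp (ucomp_instance _ ucomp_stage)); ucomp_proj.
move=> p; apply: wit_all_allinfI => k t; rewrite geq_max => /andP[ltkt].
rewrite /s; case: ex_minnP => s0 les0 _ lest.
apply/SNE; first exact: leq_ltn_trans ltkt.
apply: (label_wave_balanced (T := T p k)) les0 ltkt lest => // a n ltak leTn.
apply/DE; apply: (wit_all_allinf (proj2_sig p)); apply: leq_trans leTn.
exact/ltnW/leT.
Qed.

Lemma realizer_allSN : exists r, forall i alpha, all_witSN i alpha ->
  exists2 beta, computes r (fjoin alpha (oracle i)) beta & all_wit i beta.
Proof.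
(* A failure at [n >= a] causes a deviation above tolerance index [2a + 3] no earlier than [n], so
   the bound for that index serves for [a]. *)
pose S (p : witnessed all_witSN) a := maxn ((sval p).2 (npair a.*2.+3 0)) a.
apply: (uniform_realizer (F := fun p => all_allinf_wit (S p) (oracle (sval p).1))).
  apply: ucomp_all_allinf_wit; last exact: (ucomp_instance _ (ucomp_oracle _)).
  have uc_id := ucomp_id false (@woracle ss all_witSN).
  apply: ucomp_max => //; apply: (ucomp_comp (ucomp_witness _)).
  apply: ucomp_npair; last exact: ucomp_const.
  do 3!apply: ucomp_succ.
  by apply: ucomp_ext (ucomp_add uc_id uc_id) _ => p a; rewrite addnn.
move=> p; apply: wit_all_allinfI => a n; rewrite geq_max => /andP[lesn lean].
apply/DE; apply: contraT => /(label_wave_peak lean)[t [t0 lent]].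
rewrite ltnNge; suff -> : excess (label (D (sval p).1)) t * (a.*2.+3).+1 <= t.*2 by [].
by apply/SNE => //; apply: (wit_all_allinf (proj2_sig p)); apply: leq_trans lent.
Qed.

Let ex_peak i a : (forall m, exists2 n, m <= n & ~~ D i n a) ->
  forall m, exists t, [&& 0 < t, m <= t & t.*2 < excess (lab i) t * (a.*2.+3).+1].
Proof.
move=> bad m; have [n] := bad (maxn m a).
rewrite geq_max => /andP[lemn lean] /(label_wave_peak lean)[t [t0 lent pk]].
by exists t; rewrite t0 pk (leq_trans lemn lent).
Qed.

Let ex_bad i k :
    (forall m, exists2 t, m <= t & ~ matrix SimpNormal [:: VNat t, VNat k & y i]) ->
  forall m, exists n, (m <= n) && ~~ D i n k.
Proof.
move=> dev; apply: ex_exinf_wave_bad => [a leak | m]; first exact: descD.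
have [t ltmt nbal] := dev m.+1.
by exists t; [exact: ltnW | apply/not_SNE => //; apply: leq_ltn_trans ltmt].
Qed.

Lemma realizer_ex : exists r, forall i alpha, ex_wit i alpha ->
  exists2 beta, computes r (fjoin alpha (oracle i)) beta & ex_witSN i beta.
Proof.
have bad (p : witnessed ex_wit) m : exists2 n, m <= n & ~~ D (sval p).1 n ((sval p).2 0).
  by have [n lemn /not_DE nD] := wit_ex_exinf (proj2_sig p) m; exists n.
pose k (p : witnessed ex_wit) := ((sval p).2 0).*2.+3.
pose K p m := ex_minn (ex_peak (bad p) m).
apply: (uniform_realizer (F := fun p => ex_exinf_wit (k p) (K p) (enc (y (sval p).1)))).
  have uc_id := ucomp_id false (@woracle ss ex_wit).
  have uck : ucomp false (@woracle ss ex_wit) (fun p _ => k p).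
    do 3!apply: ucomp_succ.
    have uca := ucomp_comp (ucomp_witness ex_wit) (ucomp_const _ _ 0).
    by apply: ucomp_ext (ucomp_add uca uca) _ => p a; rewrite addnn.
  apply: ucomp_ex_exinf_wit => //; last exact: (ucomp_instance _ ucomp_seq).
  apply: (ucomp_search (P := fun p m t =>
    [&& 0 < t, m <= t & t.*2 < excess (lab (sval p).1) t * (k p).+1])).
  apply: (ucomp_and (P := fun _ q => 0 < nsnd q) (Q := fun p q => (nfst q <= nsnd q) &&
    ((nsnd q).*2 < excess (lab (sval p).1) (nsnd q) * (k p).+1))).
    by apply: ucomp_lt; [exact: ucomp_const | ucomp_proj].
  apply: ucomp_and; first by apply: ucomp_le; ucomp_proj.
  apply: ucomp_lt.
    by apply: ucomp_ext (ucomp_add (ucomp_nsnd uc_id) (ucomp_nsnd uc_id)) _ => p q;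
       rewrite addnn.
  apply: ucomp_mul; last exact: ucomp_succ.
  by apply: (ucomp_comp (ucomp_instance _ ucomp_excess)); ucomp_proj.
move=> p; apply: wit_ex_exinfI => m; rewrite /K; case: ex_minnP => t /and3P[t0 lemt pk] _.
by split=> //; apply/not_SNE.
Qed.

Lemma realizer_exSN : exists r, forall i alpha, ex_witSN i alpha ->
  exists2 beta, computes r (fjoin alpha (oracle i)) beta & ex_wit i beta.
Proof.
have dev (p : witnessed ex_witSN) := wit_ex_exinf (proj2_sig p).
pose K p m := ex_minn (ex_bad (dev p) m).
apply: (uniform_realizer
  (F := fun p => ex_exinf_wit ((sval p).2 0) (K p) (oracle (sval p).1))).
  have uca := ucomp_comp (ucomp_witness ex_witSN) (ucomp_const _ _ 0).
  apply: ucomp_ex_exinf_wit => //; last exact: (ucomp_instance _ (ucomp_oracle _)).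
  apply: (ucomp_search (P := fun p m n => (m <= n) && ~~ D (sval p).1 n ((sval p).2 0))).
  apply: (ucomp_and (P := fun _ q => nfst q <= nsnd q)
    (Q := fun p q => ~~ D (sval p).1 (nsnd q) ((sval p).2 0))).
    by apply: ucomp_le; ucomp_proj.
  apply: (ucomp_neg (P := fun p q => D (sval p).1 (nsnd q) ((sval p).2 0))).
  apply: (ucomp_app2 (F := fun p n a => D (sval p).1 n a : nat)).
  + exact: (ucomp_instance _ ucD).
  + by ucomp_proj.
  + exact: uca.
move=> p; apply: wit_ex_exinfI => m; rewrite /K; case: ex_minnP => n /andP[lemn nD] _.
by split=> //; apply/not_DE.
Qed.

Lemma le_dm_SimpNormal : le_dm (Formula [:: QAll; QAllInf] ss theta) SimpNormal.
Proof.
have [e _ eP] := ucomp_seq.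
have ssy i : instance (params SimpNormal) (y i).
  split=> // [|t]; last by rewrite /wave_seq ltnS leq_b1.
  exact: computable_rel (instance_computable (proj2_sig i)) (eP i).
exists e; split.
  have [r rP] := realizer_all; have [r' r'P] := realizer_allSN.
  exists r, r' => x ssx; pose i : inst := exist _ x ssx.
  exists (y i); split; [exact: ssy | exact: (eP i) | | exact: (rP i) | exact: (r'P i)].
  rewrite /holds /=; have [ev bal] := all_allinf_wave (D i); split=> hyp.
    move=> k; have [|s sP] := ev _ k.
      by move=> a; have [t tP] := hyp a; exists t => n /tP /(DE i).
    by exists s.+1 => t ltst; apply/SNE; [exact: leq_ltn_trans ltst | exact/sP/ltnW].
  move=> a; have [|t tP] := bal _ a; last by exists t => n /tP /DE.
  move=> k; have [s sP] := hyp k; exists s.+1 => t ltst.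
  by apply/(SNE i); [exact: leq_ltn_trans ltst | exact/sP/ltnW].
have [r rP] := realizer_ex; have [r' r'P] := realizer_exSN.
exists r, r' => x ssx; pose i : inst := exist _ x ssx.
exists (y i); split; [exact: ssy | exact: (eP i) | | exact: (rP i) | exact: (r'P i)].
rewrite /holds /=; split=> -[a inf].
  exists a.*2.+3 => m; have [|t /and3P[t0 lemt pk]] := @ex_peak i a _ m.
    by move=> m'; have [n [lemn /(not_DE i) nD]] := inf m'; exists n.
  by exists t; split=> //; apply/not_SNE.
exists a => m; have [|n /andP[lemn nD]] := @ex_bad i a _ m.
  by move=> m'; have [t [lemt nbal]] := inf m'; exists t.
by exists n; split=> //; apply/(not_DE i).
Qed.

End Reduction.

Lemma SimpNormal_complete phi : all_down_allinf phi -> le_dm phi SimpNormal.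
Proof.
case=> ss [theta [bth desc ->]].
pose o := @instance_oracle ss.
have env : uenv o (fun i p => VNat (nfst p) :: VNat (nsnd p) :: sval i).
  do 2!(apply: uenv_cons; last by ucomp_proj).
  by apply: (@uenv_enc _ _ ss (fun i => sval i)) (ucomp_oracle _) => i; case: i.
have [P ucP PE] := bounded_udecides bth env.
apply: (@le_dm_SimpNormal ss theta (fun i n a => P i (npair n a))) => //.
  by apply: ucomp_ext ucP _ => i p; rewrite npair_eta.
by move=> i n a; rewrite PE !npairE.
Qed.

Lemma all_down_allinf_SimpNormal : all_down_allinf SimpNormal.
Proof.
exists [:: SCantor], (matrix SimpNormal); split=> //; first exact: bounded_SimpNormal.
move=> k k' x _ lekk' [s sP]; exists s => t lest; apply: le_trans (sP t lest) _.
by rewrite !mul1r lef_pV2 ?posrE ?ltr0n // ler_nat.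
Qed.

Theorem mainTheorem8 : dicomplete all_down_allinf SimpNormal.
Proof.
split; first exact: bounded_SimpNormal.
exists SimpNormal; last by split; apply: le_dm_refl.
by split; [exact: all_down_allinf_SimpNormal | exact: SimpNormal_complete].
Qed.
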